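(* For each vertex $i\in\mathbb{V}$ the following holds. 1. Solving the tree-coupled system $\mathcal{B}_{\le R}x_{\le R}=h_{\le R}$ by calling the recursive procedure $\mathrm{Solve}(R,h_{\le R})$, with precomputed Schur complements, requires $\Theta(2^{\mathrm{depth}(i)})$ solutions of systems involving $B_i$; that is, there are absolute constants $0<c\le C$ such that the number of such solutions is between $c\,2^{\mathrm{depth}(i)}$ and $C\,2^{\mathrm{depth}(i)}$. 2. Computing all the Schur complements $\mathcal{S}_{\le j}$ ($j$ an inner vertex) by calling the recursive procedure $\mathrm{Schur}(R)$ requires $\mathcal{O}(\ell(i))$ solutions of systems involving $B_i$; that is, at most $C'\,\ell(i)$ for an absolute constant $C'$.
   Context: **Data.** Let $\mathbb{D}=(\mathbb{V},\mathbb{A})$ be a directed rooted tree (arborescence) with vertices $\mathbb{V}=\{1,\dots,N\}$ and arcs $\mathbb{A}=\{a_1,\dots,a_M\}$ directed away from the root $R$. Each vertex $i$ has a symmetric matrix $B_i\in\mathbb{R}^{n_i\times n_i}$ and right-hand side $h_i\in\mathbb{R}^{n_i}$; each arc $a_k=(i,j)$ has a symmetric $D_k\in\mathbb{R}^{\ell_k\times\ell_k}$, matrices $C_k^+\in\mathbb{R}^{\ell_k\times n_i}$, $C_k^-\in\mathbb{R}^{\ell_k\times n_j}$, and a right-hand side $f_k\in\mathbb{R}^{\ell_k}$. A vertex is a leaf if it has no outgoing arcs, and an inner vertex otherwise. $\mathrm{depth}(i)$ is the length of the path from $R$ to $i$. $\ell(i)$ is the sum of $\ell_k$ over all arcs $a_k$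 (outgoing or incoming) incident to $i$. For $i\neq R$ let $\kappa(i)$ be the index of the unique arc entering $i$. For an inner vertex $i$ write its outgoing arcs as $a_{k_1}=(i,j_1),\dots,a_{k_r}=(i,j_r)$. **Nested matrices.** For a leaf $i$: $\mathcal{B}_{\le i}=B_i$, $h_{\le i}=h_i$, $x_{\le i}=x_i$, and $\mathcal{C}_i^-=C^-_{\kappa(i)}$ if $i\ne R$. For an inner vertex $i$: $x_{\le i}=(x_{\le j_1},\dots,x_{\le j_r},x_i,y_{k_1},\dots,y_{k_r})$, $h_{\le i}=(h_{\le j_1},\dots,h_{\le j_r},h_i,f_{k_1},\dots,f_{k_r})$, $\mathcal{D}_{\le i}=\mathrm{blkdiag}(D_{k_1},\dots,D_{k_r})$, $\mathcal{C}^+_{\le i}$ is the vertical stacking of $C^+_{k_1},\dots,C^+_{k_r}$, $\mathcal{C}^-_{\le i}=\mathrm{blkdiag}(\mathcal{C}^-_{j_1},\dots,\mathcal{C}^-_{j_r})$, and $$\mathcal{B}_{\le i}=\begin{pmatrix}\mathrm{blkdiag}(\mathcal{B}_{\le j_1},\dots,\mathcal{B}_{\le j_r}) & 0 & -(\mathcal{C}^-_{\le i})^T\\ 0 & B_i & (\mathcal{C}^+_{\le i})^T\\ -\mathcal{C}^-_{\le i} & \mathcal{C}^+_{\le i} & -\mathcal{D}_{\le i}\end{pmatrix};$$ for $i\neq R$, $\mathcal{C}_i^-=(0\ \cdots\ 0\ C^-_{\kappa(i)}\ 0)$, where $C^-_{\kappa(i)}$ occupies the columns of $\mathcal{B}_{\le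 i}$ containing the diagonal block $B_i$. For inner $i$, $$\mathcal{S}_{\le i}=\begin{pmatrix}-\mathcal{C}^-_{\le i}&\mathcal{C}^+_{\le i}\end{pmatrix}\mathrm{blkdiag}(\mathcal{B}_{\le j_1}^{-1},\dots,\mathcal{B}_{\le j_r}^{-1},B_i^{-1})\begin{pmatrix}-\mathcal{C}^-_{\le i}&\mathcal{C}^+_{\le i}\end{pmatrix}^T+\mathcal{D}_{\le i}.$$ **Standing assumptions.** All $B_i$ and all $\mathcal{B}_{\le i}$ are invertible, and all $\mathcal{S}_{\le i}$ ($i$ inner) are positive definite. Moreover, with $\mathcal{B}=\mathrm{blkdiag}(B_1,\dots,B_N)$, $\mathcal{D}=\mathrm{blkdiag}(D_1,\dots,D_M)$ and $\mathcal{C}$ the block matrix whose block row for $a_k=(i,j)$ has $C_k^+$ in block column $i$, $-C_k^-$ in block column $j$ and zeros elsewhere, the matrix $\mathcal{C}\mathcal{B}^{-1}\mathcal{C}^T+\mathcal{D}$ is positive definite. **Counting.** A ''solution of a system involving $B_i$'' is the computation of $B_i^{-1}g$ for one vector $g$; only explicit such computations in the procedures below are counted, and solves with the matrices $\mathcal{S}_{\le i}$ and matrix–vector products are free. **Procedure $\mathrm{Solve}(i,h_{\le i})$** (returns $\mathcal{B}_{\le i}^{-1}h_{\le i}$). If $i$ is a leaf, return $B_i^{-1}h_i$. Otherwise: compute $B_i^{-1}h_i$ once; for each $l=1,\dots,r$ compute $\hat y_l=\mathrm{Solve}(j_l,h_{\le j_l})$ and $\hat x_l=-\mathcal{C}^-_{j_l}\hat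 y_l+C^+_{k_l}B_i^{-1}h_i-f_{k_l}$; compute $(y_{k_1},\dots,y_{k_r})=\mathcal{S}_{\le i}^{-1}(\hat x_1,\dots,\hat x_r)$; compute $x_i=B_i^{-1}\bigl(h_i-\sum_l (C^+_{k_l})^Ty_{k_l}\bigr)$; for each $l$ compute $x_{\le j_l}=\mathrm{Solve}(j_l,\,h_{\le j_l}+(\mathcal{C}^-_{j_l})^Ty_{k_l})$; return $x_{\le i}$. **Procedure $\mathrm{Schur}(i)$** (returns all $\mathcal{S}_{\le j}$ for inner $j$ in the subtree rooted at $i$). If $i$ is a leaf, return nothing. Otherwise: call $\mathrm{Schur}(j_l)$ once for each child $j_l$; for each $l$ compute $Z_l=B_i^{-1}(C^+_{k_l})^T$ column by column; set the $(l,l')$ block of $\mathcal{S}_{\le i}$ to $C^+_{k_l}Z_{l'}$ for all $l,l'$; for each $l$ add $\mathrm{Out}(j_l)+D_{k_l}$ to the $(l,l)$ block. **Procedure $\mathrm{Out}(i)$** for $i\ne R$ (returns $\mathcal{C}_i^-\mathcal{B}_{\le i}^{-1}(\mathcal{C}_i^-)^T$). For each column $g$ of $(C^-_{\kappa(i)})^T$: compute $z=B_i^{-1}g$; if $i$ is inner, compute $(y_{k_1},\dots,y_{k_r})=\mathcal{S}_{\le i}^{-1}(C^+_{k_1}z,\dots,C^+_{k_r}z)$; compute the column $B_i^{-1}\bigl(g-\sum_l(C^+_{k_l})^Ty_{k_l}\bigr)$ (with empty sum if $i$ is a leaf). Collect these columns in a matrix $Z$ and return $C^-_{\kappa(i)}Z$.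 *)

(* Defs.v *)
From mathcomp Require Import all_boot all_order all_algebra.
From mathcomp Require Import boolp reals.

Set Implicit Arguments.
Unset Strict Implicit.
Unset Printing Implicit Defensive.

Import Order.TTheory GRing.Theory Num.Theory.
Local Open Scope ring_scope.

(* [walk tl hd u p v]: the arcs of [p], in order, form a directed walk from
   [u] to [v]. *)
Fixpoint walk (N M : nat) (tl hd : 'I_M -> 'I_N)
    (u : 'I_N) (p : seq 'I_M) (v : 'I_N) : bool :=
  if p is k :: p' then (tl k == u) && walk tl hd (hd k) p' v else u == v.

(* A finite directed multigraph in which every vertex is the end of exactly one
   directed walk from the root.  Walks may repeat vertices, so this excludes
   arcs entering the root, second arcs entering a vertex, and cycles. *)
Record arborescence := Arborescence {
  nvertices : nat;
  narcs : nat;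
  arc_tail : 'I_narcs -> 'I_nvertices;
  arc_head : 'I_narcs -> 'I_nvertices;
  troot : 'I_nvertices;
  root_walk_ex : forall v, exists p, walk arc_tail arc_head troot p v;
  root_walk_uniq : forall v p q,
    walk arc_tail arc_head troot p v -> walk arc_tail arc_head troot q v -> p = q
}.

Section Tree.
Context (G : arborescence).

Definition vertex := 'I_(nvertices G).
Definition arc := 'I_(narcs G).

Definition root_path (i : vertex) : seq arc := xchoose (root_walk_ex i).
Definition depth (i : vertex) : nat := size (root_path i).

Definition outdeg (i : vertex) : nat := #|[set k : arc | arc_tail k == i]|.

(* The outgoing arcs of [i] are listed in increasing order. *)
Definition out_arc (i : vertex) (l : 'I_(outdeg i)) : arc := enum_val l.
Definition child (i : vertex) (l : 'I_(outdeg i)) : vertex := arc_head (out_arc l).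

Lemma tail_out_arc (i : vertex) (l : 'I_(outdeg i)) : arc_tail (out_arc l) = i.
Proof. by have := enum_valP l; rewrite inE => /eqP. Qed.

(* An element of [subtree i] is the recursion scheme "leaf or inner vertex"
   below [i]; it carries no choice (lemma [subtree_irrelevance]) and exists for
   every [i] ([subtree_of]).  It makes the recursive definitions structural. *)
Inductive subtree : vertex -> Type :=
| Leaf (i : vertex) of outdeg i = 0%N : subtree i
| Inner (i : vertex) of (0 < outdeg i)%N &
    (forall l : 'I_(outdeg i), subtree (child l)) : subtree i.

Lemma walk_rcons (u : vertex) (p : seq arc) (k : arc) :
  walk (@arc_tail G) (@arc_head G) u p (arc_tail k) ->
  walk (@arc_tail G) (@arc_head G) u (rcons p k) (arc_head k).
Proof.
elim: p u => [|a p IHp] u /=; first by move=> /eqP ->; rewrite !eqxx.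
by case/andP=> -> /IHp.
Qed.

Lemma root_pathP (i : vertex) :
  walk (@arc_tail G) (@arc_head G) (troot G) (root_path i) i.
Proof. exact: (xchooseP (root_walk_ex i)). Qed.

Lemma root_path_head (k : arc) :
  root_path (arc_head k) = rcons (root_path (arc_tail k)) k.
Proof.
apply: (@root_walk_uniq G (arc_head k)); first exact: root_pathP.
exact/walk_rcons/root_pathP.
Qed.

Lemma depth_child (i : vertex) (l : 'I_(outdeg i)) :
  depth (child l) = (depth i).+1.
Proof.
by rewrite /depth /child root_path_head size_rcons tail_out_arc.
Qed.

Lemma entering_arc_uniq (k k' : arc) : arc_head k = arc_head k' -> k = k'.
Proof.
move=> e; have := root_path_head k; rewrite e root_path_head.
by move=> /(congr1 (last k)); rewrite !last_rcons.
Qed.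

Lemma entering_arc_ex (i : vertex) : i != troot G -> exists k : arc, arc_head k = i.
Proof.
move=> iR; have := root_pathP i; move: iR; elim: (root_path i) (troot G).
  by move=> u /negPf ui /= /eqP e; rewrite e eqxx in ui.
move=> k p IHp u _ /= /andP[_]; have [->|ne] := eqVneq i (arc_head k).
  by exists k.
exact: IHp.
Qed.

Lemma depth_bound (i : vertex) : (depth i < nvertices G)%N.
Proof.
have prefix (p q : seq arc) (u v : vertex) :
    walk (@arc_tail G) (@arc_head G) u (p ++ q) v ->
    exists w : vertex, walk (@arc_tail G) (@arc_head G) u p w.
  elim: p u => [|a p IHp] u /=; first by exists u.
  by case/andP=> -> /IHp.
pose w (j : 'I_(depth i).+1) : vertex :=
  xchoose (prefix (take j (root_path i)) (drop j (root_path i)) _ i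
    (eq_ind_r (fun s => is_true (walk _ _ (troot G) s i)) (root_pathP i)
       (cat_take_drop j (root_path i)))).
have wP (j : 'I_(depth i).+1) : walk (@arc_tail G) (@arc_head G) (troot G) (take j (root_path i)) (w j).
  exact: (xchooseP (prefix _ _ _ _ _)).
have w_inj : injective w.
  move=> j j' e; have := wP j; rewrite e => /(@root_walk_uniq G (w j')).
  move=> /(_ _ (wP j')) /(congr1 size); rewrite !size_takel; last 2 first.
  - by rewrite -ltnS.
  - by rewrite -ltnS.
  by move/val_inj.
by have := leq_card w w_inj; rewrite !card_ord.
Qed.

Lemma subtree_inhabited (i : vertex) : inhabited (subtree i).
Proof.
have [d] := ubnP (nvertices G - depth i); elim: d i => // d IHd i le_d.
have [i0|i_gt0] := posnP (outdeg i); first exact: inhabits (Leaf i0).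
suff t (l : 'I_(outdeg i)) : inhabited (subtree (child l)).
  by apply: inhabits; apply: Inner => // l; apply: inhabited_witness.
apply: IHd; rewrite depth_child; move: le_d; rewrite ltnS; apply: leq_trans.
by rewrite subnS ltn_predL subn_gt0 depth_bound.
Qed.

Definition subtree_of (i : vertex) : subtree i :=
  inhabited_witness (subtree_inhabited i).

Lemma subtree_irrelevance (i : vertex) (t t' : subtree i) : t = t'.
Proof.
elim: t t' => {i} [i i0|i i_gt0 ch IHch] t'.
  case: t' i0 => {i} [i i0'|i i_gt0 ch] i0.
    by rewrite (eq_irrelevance i0 i0').
  by exfalso; move: i_gt0; rewrite i0.
case: t' i_gt0 ch IHch => {i} [i i0|i i_gt0' ch'] i_gt0 ch IHch.
  by exfalso; move: i_gt0; rewrite i0.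
rewrite (eq_irrelevance i_gt0 i_gt0'); congr Inner.
by apply: functional_extensionality_dep => l; exact: IHch.
Qed.

End Tree.

Arguments Leaf {G i}.
Arguments Inner {G i}.

Definition posdefmx (R : realType) (n : nat) (A : 'M[R]_n) : Prop :=
  A^T = A /\ forall x : 'cV[R]_n, x != 0 -> 0 < (x^T *m A *m x) 0 0.

(* Block diagonal matrix with rectangular blocks; [\mxdiag] only accepts square
   ones.  As in [\mxdiag], [conform_mx 0] is the identity when [l == l']. *)
Definition mxrdiag (R : realType) (r : nat) (p q : 'I_r -> nat)
    (A : forall l, 'M[R]_(p l, q l)) : 'M[R]_(\sum_l p l, \sum_l q l) :=
  \mxblock_(l, l') (if l == l' then conform_mx 0 (A l) else 0).

Record tree_system (R : realType) (G : arborescence) := TreeSystem {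
  vdim : vertex G -> nat;
  adim : arc G -> nat;
  Bv : forall i, 'M[R]_(vdim i);
  hv : forall i, 'cV[R]_(vdim i);
  Da : forall k, 'M[R]_(adim k);
  Cp : forall k, 'M[R]_(adim k, vdim (arc_tail k));
  Cm : forall k, 'M[R]_(adim k, vdim (arc_head k));
  fa : forall k, 'cV[R]_(adim k);
  Bv_sym : forall i, (Bv i)^T = Bv i;
  Da_sym : forall k, (Da k)^T = Da k
}.

Section System.
Context (R : realType) (G : arborescence) (sys : tree_system R G).

Local Notation n := (vdim sys).
Local Notation ell := (adim sys).
Local Notation B := (Bv sys).
Local Notation D := (Da sys).

Definition incident_dim (i : vertex G) : nat :=
  (\sum_(k : arc G | (arc_tail k == i) || (arc_head k == i)) ell k)%N.

(* Moves the columns of [A] to block column [i]: [A] if [j = i], else 0. *)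
Definition at_block (m : nat) (j : vertex G) (A : 'M[R]_(m, n j))
    (i : vertex G) : 'M[R]_(m, n i) :=
  if j =P i is ReflectT e then castmx (erefl m, congr1 n e) A else 0.

Definition Bglobal : 'M[R]_(\sum_i n i) := \mxdiag_i B i.
Definition Dglobal : 'M[R]_(\sum_k ell k) := \mxdiag_k D k.

(* No arc of an arborescence is a loop, so each block has at most one nonzero
   summand. *)
Definition Cglobal : 'M[R]_(\sum_k ell k, \sum_i n i) :=
  \mxblock_(k, i) (at_block (Cp sys k) i - at_block (Cm sys k) i).

Definition Sglobal : 'M[R]_(\sum_k ell k) :=
  Cglobal *m invmx Bglobal *m Cglobal^T + Dglobal.

(* [C^+_{k_l}] with its column dimension read at [i], the tail of [a_{k_l}]. *)
Definition Cout (i : vertex G) (l : 'I_(outdeg i)) :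
    'M[R]_(ell (out_arc l), n i) :=
  castmx (erefl, congr1 n (tail_out_arc l)) (Cp sys (out_arc l)).

Definition sdim (i : vertex G) : nat :=
  (\sum_(l < outdeg i) ell (out_arc l))%N.

Fixpoint dim_le (i : vertex G) (t : subtree i) : nat :=
  match t with
  | @Leaf _ i _ => n i
  | @Inner _ i _ ch => (\sum_(l < outdeg i) dim_le (ch l) + n i + sdim i)%N
  end.

Fixpoint h_le (i : vertex G) (t : subtree i) : 'cV[R]_(dim_le t) :=
  match t with
  | @Leaf _ i _ => hv sys i
  | @Inner _ i _ ch =>
      col_mx (col_mx (\mxcol_l h_le (ch l)) (hv sys i))
             (\mxcol_l fa sys (out_arc l))
  end.

(* [(0 ... 0 C 0)], with [C] in the columns of the diagonal block [B i]. *)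
Definition own_cols (m : nat) (i : vertex G) (t : subtree i) :
    'M[R]_(m, n i) -> 'M[R]_(m, dim_le t) :=
  match t with
  | @Leaf _ i _ => fun C => C
  | @Inner _ i _ ch => fun C => row_mx (row_mx 0 C) 0
  end.

(* [C_j^-] for [j = arc_head k]; since [k] is the only arc entering [j]
   ([entering_arc_uniq]), [k] is the arc [kappa(j)]. *)
Definition Cin (k : arc G) (t : subtree (arc_head k)) :
    'M[R]_(ell k, dim_le t) :=
  own_cols t (Cm sys k).

Section InnerBlocks.
Context (i : vertex G) (ch : forall l : 'I_(outdeg i), subtree (child l)).

Definition Dout_le : 'M[R]_(sdim i) := \mxdiag_l D (out_arc l).

Definition Cplus_le : 'M[R]_(sdim i, n i) := \mxcol_l Cout l.

Definition Cminus_le : 'M[R]_(sdim i, \sum_l dim_le (ch l)) :=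
  mxrdiag (fun l => Cin (ch l)).

End InnerBlocks.

Fixpoint B_le (i : vertex G) (t : subtree i) : 'M[R]_(dim_le t) :=
  match t with
  | @Leaf _ i _ => B i
  | @Inner _ i _ ch =>
      block_mx
        (block_mx (\mxdiag_l B_le (ch l)) 0 0 (B i))
        (col_mx (- (Cminus_le ch)^T) (Cplus_le i)^T)
        (row_mx (- Cminus_le ch) (Cplus_le i))
        (- Dout_le i)
  end.

(* The Schur complement at an inner vertex; a dummy (0 x 0) matrix at leaves. *)
Definition S_le (i : vertex G) (t : subtree i) : 'M[R]_(sdim i) :=
  match t with
  | @Leaf _ i _ => 0
  | @Inner _ i _ ch =>
      let C := row_mx (- Cminus_le ch) (Cplus_le i) in
      C *m block_mx (\mxdiag_l invmx (B_le (ch l))) 0 0 (invmx (B i)) *m C^T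
      + Dout_le i
  end.

Record standing_assumptions : Prop := StandingAssumptions {
  B_unit : forall i, B i \in unitmx;
  B_le_unit : forall i, B_le (subtree_of i) \in unitmx;
  S_le_posdef : forall i, (0 < outdeg i)%N -> posdefmx (S_le (subtree_of i));
  Sglobal_posdef : posdefmx Sglobal
}.

(* A result, together with the list, in order of execution, of the vertices [i]
   for which a vector [B_i^{-1} g] was computed. *)
Definition comp (X : Type) : Type := (X * seq (vertex G))%type.

Definition ret (X : Type) (x : X) : comp X := (x, [::]).

Definition bind (X Y : Type) (c : comp X) (f : X -> comp Y) : comp Y :=
  ((f c.1).1, c.2 ++ (f c.1).2).

Local Notation "x <- c ;; d" := (bind c (fun x => d))
  (at level 90, c at next level, d at level 200, right associativity).

Definition for_each (r : nat) (X : 'I_r -> Type) (f : forall l, comp (X l)) :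
    comp (forall l, X l) :=
  (fun l => (f l).1, flatten [seq (f l).2 | l <- enum 'I_r]).

Definition for_cols (m p q : nat) (f : 'cV[R]_m -> comp 'cV[R]_p)
    (A : 'M[R]_(m, q)) : comp 'M[R]_(p, q) :=
  c <- for_each (fun s : 'I_q => f (col s A)) ;;
  ret (\matrix_(a, s) c s a 0).

Definition solveB (i : vertex G) (g : 'cV[R]_(n i)) : comp 'cV[R]_(n i) :=
  (invmx (B i) *m g, [:: i]).

Definition num_solves (X : Type) (c : comp X) (i : vertex G) : nat :=
  count_mem i c.2.

Fixpoint schur_table (i : vertex G) (t : subtree i) : Type :=
  match t with
  | @Leaf _ _ _ => unit
  | @Inner _ i _ ch => ('M[R]_(sdim i) * (forall l, schur_table (ch l)))%type
  end.

Fixpoint S_table (i : vertex G) (t : subtree i) : schur_table t :=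
  match t with
  | @Leaf _ _ _ => tt
  | @Inner _ i i_gt0 ch => (S_le (Inner i_gt0 ch), fun l => S_table (ch l))
  end.

(* The blocks of [g] play the roles of [h_{<=j_l}], [h_i] and [f_{k_l}]. *)
Fixpoint Solve (i : vertex G) (t : subtree i) :
    schur_table t -> 'cV[R]_(dim_le t) -> comp 'cV[R]_(dim_le t) :=
  match t with
  | @Leaf _ i _ => fun _ g => solveB g
  | @Inner _ i _ ch => fun S g =>
      let gch l := submxcol (usubmx (usubmx g)) l in
      let gi := dsubmx (usubmx g) in
      let gf l := submxcol (dsubmx g) l in
      u <- solveB gi ;;
      yh <- for_each (fun l => Solve (S.2 l) (gch l)) ;;
      let xh := \mxcol_l (- (Cin (ch l) *m yh l) + Cout l *m u - gf l) in
      let y := invmx S.1 *m xh in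
      let yl l := submxcol y l in
      x <- solveB (gi - \sum_l (Cout l)^T *m yl l) ;;
      xch <- for_each (fun l =>
               Solve (S.2 l) (gch l + (Cin (ch l))^T *m yl l)) ;;
      ret (col_mx (col_mx (\mxcol_l xch l) x) y)
  end.

Definition Out_col (i : vertex G) (t : subtree i) :
    schur_table t -> 'cV[R]_(n i) -> comp 'cV[R]_(n i) :=
  match t with
  | @Leaf _ i _ => fun _ g =>
      z <- solveB g ;;
      solveB g
  | @Inner _ i _ ch => fun S g =>
      z <- solveB g ;;
      let y := invmx S.1 *m (\mxcol_l (Cout l *m z)) in
      solveB (g - \sum_l (Cout l)^T *m submxcol y l)
  end.

(* [Out(arc_head k)]; see [Cin]. *)
Definition Out (k : arc G) (t : subtree (arc_head k)) (S : schur_table t) :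
    comp 'M[R]_(ell k) :=
  Z <- for_cols (Out_col S) (Cm sys k)^T ;;
  ret (Cm sys k *m Z).

(* [Out(j_l)] uses the Schur complements returned by the call [Schur(j_l)]. *)
Fixpoint Schur (i : vertex G) (t : subtree i) : comp (schur_table t) :=
  match t with
  | @Leaf _ _ _ => ret tt
  | @Inner _ i _ ch =>
      S <- for_each (fun l => Schur (ch l)) ;;
      Z <- for_each (fun l => for_cols (@solveB i) (Cout l)^T) ;;
      O <- for_each (fun l => Out (S l)) ;;
      ret (\mxblock_(l, l') (Cout l *m Z l')
           + \mxdiag_l (O l + D (out_arc l)), S)
  end.

Definition Solve_root : comp 'cV[R]_(dim_le (subtree_of (troot G))) :=
  Solve (S_table (subtree_of (troot G))) (h_le (subtree_of (troot G))).

Definition Schur_root : comp (schur_table (subtree_of (troot G))) :=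
  Schur (subtree_of (troot G)).

End System.

(* Main.v *)
Require Import Defs.
From mathcomp Require Import all_boot all_order all_algebra.
From mathcomp Require Import reals.
From mathcomp Require Import zify.
Import Order.TTheory GRing.Theory Num.Theory.
Local Open Scope ring_scope.

Set Implicit Arguments.
Unset Strict Implicit.
Unset Printing Implicit Defensive.

(** The cost of either procedure at a fixed vertex [i] obeys a linear recursion
    along the tree that does not see the numerical data: a call at [j] pays a
    fixed price [w] if [j = i], plus [m] times the price of one call at each
    child of [j].  [visits m w t i] is the solution of this recursion.  In an
    arborescence at most one child of [j] leads to [i], so nothing adds up
    across siblings, and unrolling the recursion along the path from the root
    to [i] gives [m ^ depth i * w] ([visits_root]).

    [Solve] calls itself twice at each child, so [m = 2], and its own price is
    one solution at a leaf and two at an inner vertex ([num_solves_Solve]);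
    hence the bounds with constants 1 and 2.

    [Schur] calls itself once at each child, so [m = 1].  It charges [i] one
    solution per row of each outgoing [C^+], and the call of [Out] made by the
    parent of [i] charges two per row of the incoming [C^-].  Once this second
    charge is booked at [i] itself instead of at its parent, the recursion has
    the above form with [w] equal to the outgoing dimension plus twice the
    incoming one ([num_solves_Schur]).  Both dimensions are bounded by the
    incident dimension, whence the constant 3. *)

Section Walks.
Context {G : arborescence}.
Local Notation walkG := (walk (@arc_tail G) (@arc_head G)).

Lemma walk_cat (u v w : vertex G) (p q : seq (Defs.arc G)) :
  walkG u p v -> walkG v q w -> walkG u (p ++ q) w.
Proof.
by elim: p u => [|a p IHp] u /= => [/eqP ->|/andP[-> /IHp]].
Qed.

(** Prefixing the path from the root reduces this to the uniqueness of walks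
    starting at the root. *)
Lemma walk_uniq (u v : vertex G) (p q : seq (Defs.arc G)) :
  walkG u p v -> walkG u q v -> p = q.
Proof.
move=> /(walk_cat (root_pathP u)) up /(walk_cat (root_pathP u)) uq.
have /(congr1 (drop (size (root_path u)))) := root_walk_uniq up uq.
by rewrite !drop_size_cat.
Qed.

Lemma walk_child (j i : vertex G) (l : 'I_(outdeg j)) (p : seq (Defs.arc G)) :
  walkG (child l) p i -> walkG j (out_arc l :: p) i.
Proof. by move=> cp; rewrite /= tail_out_arc eqxx. Qed.

Lemma out_arc_inj (j : vertex G) : injective (@out_arc G j).
Proof. exact: enum_val_inj. Qed.

Lemma out_arcP (k : Defs.arc G) : exists l : 'I_(outdeg (arc_tail k)), out_arc l = k.
Proof.
have kT : k \in [set k' : Defs.arc G | arc_tail k' == arc_tail k] by rewrite inE.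
by exists (enum_rank_in kT k); rewrite /out_arc enum_rankK_in.
Qed.

Fixpoint visits (m w : nat) (j : vertex G) (t : subtree j) (i : vertex G) : nat :=
  match t with
  | @Leaf _ j _ => ((j == i) * w)%N
  | @Inner _ j _ ch =>
      ((j == i) * w + m * \sum_(l < outdeg j) visits m w (ch l) i)%N
  end.

Lemma visits_unreached m w (j i : vertex G) (t : subtree j) :
  (forall p, ~~ walkG j p i) -> visits m w t i = 0%N.
Proof.
elim: t => {j} [j j0|j jp ch IHch] noji /=; have /= /negPf -> := noji [::] => //.
rewrite big1 ?muln0 // => l _; apply: IHch => p.
by apply: contraNN (noji (out_arc l :: p)); apply: walk_child.
Qed.

(** By uniqueness of walks the first arc of the walk is the only one that leads
    to [i], so a single term of the sum over the children survives. *)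
Lemma visits_walk m w (j i : vertex G) (t : subtree j) (p : seq (Defs.arc G)) :
  walkG j p i -> visits m w t i = (m ^ size p * w)%N.
Proof.
elim: t p => {j} [j j0|j jp ch IHch] [|k p] ji.
- by move: ji => /= ->; rewrite expn0.
(* a leaf has no outgoing arc to start a nonempty walk *)
- case/andP: ji => /eqP kj _; have [l _] := out_arcP k.
  by exfalso; case: l; rewrite kj j0.
- rewrite /= -/(walkG j [::] i) ji expn0 big1 ?muln0 ?addn0 // => l _.
  apply: visits_unreached => q; apply/negP => /walk_child lq.
  by have := walk_uniq ji lq.
- have /negPf nji : j != i.
    apply/negP => e; have e0 : walkG j [::] i by [].
    by have := walk_uniq e0 ji.
  have [l kl] : exists l : 'I_(outdeg j), out_arc l = k.
    by case/andP: (ji) => /eqP <- _; exact: out_arcP.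
  move: ji; rewrite -{}kl => ji.
  rewrite /= nji mul0n add0n (bigD1 l) //= big1 => [|l' l'l].
    rewrite addn0 (IHch l p); first by rewrite expnS mulnA.
    by case/andP: ji.
  apply: visits_unreached => q; apply/negP => /walk_child lq.
  have [/out_arc_inj ll' _] := walk_uniq ji lq.
  by rewrite ll' eqxx in l'l.
Qed.

Lemma visits_root m w (t : subtree (troot G)) (i : vertex G) :
  visits m w t i = (m ^ depth i * w)%N.
Proof. exact/visits_walk/root_pathP. Qed.

End Walks.

Section Counts.
Context {R : realType} {G : arborescence} (sys : tree_system R G).
Implicit Types (i j : vertex G).

Lemma num_solves_bind (X Y : Type) (c : Defs.comp G X) (f : X -> Defs.comp G Y) i :
  num_solves (bind c f) i = (num_solves c i + num_solves (f c.1) i)%N.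
Proof. exact: count_cat. Qed.

Lemma num_solves_for_each r (X : 'I_r -> Type) (f : forall l, Defs.comp G (X l)) i :
  num_solves (for_each f) i = (\sum_(l < r) num_solves (f l) i)%N.
Proof.
by rewrite /num_solves /= count_flatten -map_comp sumnE big_map big_enum.
Qed.

Lemma num_solves_solveB j (g : 'cV[R]_(vdim sys j)) i :
  num_solves (solveB g) i = (j == i).
Proof. by rewrite /num_solves /= addn0. Qed.

Lemma num_solves_for_cols m p q (f : 'cV[R]_m -> Defs.comp G 'cV[R]_p) (A : 'M_(m, q))
    i (w : nat) :
  (forall g, num_solves (f g) i = w) -> num_solves (for_cols f A) i = (q * w)%N.
Proof.
move=> fw; rewrite num_solves_bind num_solves_for_each addn0.
by rewrite (eq_bigr (fun=> w)) ?sum_nat_const ?card_ord // => l _; exact: fw.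
Qed.

Lemma num_solves_Solve j (t : subtree j) (S : schur_table sys t) g i :
  num_solves (Solve S g) i = visits 2 (1 + (0 < outdeg i)) t i.
Proof.
elim: t S g => {j} [j j0|j j_gt0 ch IHch] S g /=.
  rewrite num_solves_solveB; case: eqVneq => // <-.
  by rewrite j0.
rewrite !(num_solves_bind, num_solves_for_each, num_solves_solveB) addn0.
rewrite !(eq_bigr _ (fun l _ => IHch l _ _)).
have -> : ((j == i) * (1 + (0 < outdeg i)) = (j == i) + (j == i))%N.
  by case: eqVneq => // <-; rewrite j_gt0.
lia.
Qed.

Lemma num_solves_Out_col j (t : subtree j) (S : schur_table sys t) g i :
  num_solves (Out_col S g) i = ((j == i) * 2)%N.
Proof.
by case: t S g => * /=; rewrite num_solves_bind !num_solves_solveB addnn muln2.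
Qed.

Lemma num_solves_Out (k : Defs.arc G) (t : subtree (arc_head k))
    (S : schur_table sys t) i :
  num_solves (Out S) i = ((arc_head k == i) * (2 * adim sys k))%N.
Proof.
rewrite num_solves_bind addn0 (num_solves_for_cols _ (w := (arc_head k == i) * 2)).
  by rewrite mulnCA (mulnC 2).
by move=> g; exact: num_solves_Out_col.
Qed.

Definition in_dim i : nat :=
  (\sum_(k : Defs.arc G | arc_head k == i) adim sys k)%N.

Lemma in_dim_head (k : Defs.arc G) : in_dim (arc_head k) = adim sys k.
Proof.
rewrite /in_dim (bigD1 k) //= big1 ?addn0 // => k' /andP[/eqP /entering_arc_uniq ->].
by rewrite eqxx.
Qed.

(** The term added on the left is what the call [Out(i)] made by the parent of
    [i] costs, so that the whole price of [i] appears at [i]. *)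
Lemma num_solves_Schur j (t : subtree j) i :
  (num_solves (Defs.Schur sys t) i + (j == i) * (2 * in_dim i))%N
  = visits 1 (sdim sys i + 2 * in_dim i) t i.
Proof.
elim: t => {j} [j j0|j j_gt0 ch IHch] /=.
  rewrite add0n; case: eqVneq => // <-.
  (* a leaf has outgoing dimension 0 *)
  by rewrite /sdim big1 // => l; exfalso; case: l; rewrite j0.
have colsE l : num_solves (for_cols (@solveB R G sys j) (Cout sys l)^T) i
    = (adim sys (out_arc l) * (j == i))%N.
  by rewrite (num_solves_for_cols _ (w := j == i)) // => g; exact: num_solves_solveB.
have outE l (S : schur_table sys (ch l)) :
    num_solves (Out S) i = ((child l == i) * (2 * in_dim i))%N.
  by rewrite num_solves_Out -/(child l); case: eqVneq => // <-; rewrite in_dim_head.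
rewrite !(num_solves_bind, num_solves_for_each) addn0 mul1n.
rewrite (eq_bigr _ (fun l _ => colsE l)) (eq_bigr _ (fun l _ => outE l _)).
rewrite -(eq_bigr _ (fun l _ => IHch l)) big_split /= -big_distrl /= -/(sdim sys j).
have -> : (sdim sys j * (j == i) = (j == i) * sdim sys i)%N.
  by rewrite mulnC; case: eqVneq => // ->.
lia.
Qed.

Lemma sdim_out i : sdim sys i = (\sum_(k : Defs.arc G | arc_tail k == i) adim sys k)%N.
Proof.
rewrite /sdim /out_arc -(big_enum_val (adim sys)) /=.
by apply: eq_bigl => k; rewrite inE.
Qed.

Lemma dims_le_incident i :
  (sdim sys i + 2 * in_dim i <= 3 * incident_dim sys i)%N.
Proof.
have sub (P Q : pred (Defs.arc G)) : (forall k, P k -> Q k) ->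
    (\sum_(k | P k) adim sys k <= \sum_(k | Q k) adim sys k)%N.
  move=> PQ; rewrite big_mkcond [leqRHS]big_mkcond; apply: leq_sum => k _.
  by case Pk: (P k) => //; rewrite PQ.
rewrite -[3%N]/(1 + 2)%N mulnDl mul1n leq_add ?leq_mul2l //= ?sdim_out /incident_dim.
  by apply: sub => k ->.
by apply: sub => k ->; rewrite orbT.
Qed.

End Counts.

Theorem lemma2p1 (R : realType) :
  exists c C C' : R,
    [/\ 0 < c, c <= C &
      forall (G : arborescence) (sys : tree_system R G),
        standing_assumptions sys ->
        forall i : vertex G,
          (c * 2 ^+ depth i <= (num_solves (Solve_root sys) i)%:R
             <= C * 2 ^+ depth i)
          /\ (num_solves (Schur_root sys) i)%:R
             <= C' * (incident_dim sys i)%:R].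
Proof.
exists 1, 2, 3; split; rewrite ?ltr01 ?ler1n // => G sys _ i; split.
  rewrite /Solve_root num_solves_Solve visits_root natrM natrX mul1r.
  rewrite ler_peMr ?exprn_ge0 ?ler0n ?ler1n //= mulrC ler_wpM2r ?exprn_ge0 ?ler0n //.
  by rewrite ler_nat; case: (0 < outdeg i)%N.
rewrite -natrM ler_nat; apply: leq_trans (dims_le_incident sys i).
apply: leq_trans (leq_addr ((troot G == i) * (2 * in_dim sys i)) _) _.
by rewrite /Schur_root num_solves_Schur visits_root exp1n mul1n.
Qed.
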